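(* Let $X$ be a set of reals (a subspace of $\mathbb{R}$). The following statements are equivalent: (1) $B(X)$ satisfies $S_{1}(\mathcal{S},\mathcal{S})$ and $B(X)$ is sequentially separable; (2) $X$ satisfies $S_{1}(B_{\Gamma}, B_{\Gamma})$; (3) $B(X)$ satisfies $S_{fin}(\mathcal{S},\mathcal{S})$ and $B(X)$ is sequentially separable; (4) $X$ satisfies $S_{fin}(B_{\Gamma}, B_{\Gamma})$; (5) $B_1(X)$ satisfies $S_{1}(\mathcal{S},\mathcal{S})$; (6) $X$ satisfies $S_{1}(F_{\Gamma}, F_{\Gamma})$; (7) $B_1(X)$ satisfies $S_{fin}(\mathcal{S},\mathcal{S})$.
   Context: $B(X)$ denotes the set of all real-valued Borel functions on $X$ and $B_1(X)$ the set of all real-valued functions of the first Baire class on $X$ (pointwise limits of sequences of continuous functions), both with the topology of pointwise convergence (subspace topology of $\mathbb{R}^X$). Selection principles: for families $\mathcal{A},\mathcal{B}$ of sets of subsets of a set, $S_1(\mathcal{A},\mathcal{B})$ means: for every sequence $(A_n:n\in\mathbb{N})$ of elements of $\mathcal{A}$ there are $b_n\in A_n$ with $\{b_n:n\in\mathbb{N}\}\in\mathcal{B}$; $S_{fin}(\mathcal{A},\mathcal{B})$ means: for every sequence $(A_n)$ of elements of $\mathcal{A}$ there are finite $B_n\subseteq A_n$ with $\bigcup_n B_n\in\mathcal{B}$. For a topological space $Y$: $\mathcal{S}$ is the family of all countable sequentially dense subsets of $Y$, where $D\subseteq Y$ is sequentially dense if every point of $Y$ is the limit of a sequence of points of $D$;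 $Y$ is sequentially separable if it has a countable sequentially dense subset. A cover $\mathcal{U}$ of $X$ is a $\gamma$-cover if it is infinite and each $x\in X$ belongs to all but finitely many members of $\mathcal{U}$. $B_\Gamma$ is the family of all countable $\gamma$-covers of $X$ by Borel sets, and $F_\Gamma$ is the family of all countable $\gamma$-covers of $X$ by closed sets. *)

(* Defs.v *)
From HB Require Import structures.
From mathcomp Require Import all_boot all_order all_algebra.
From mathcomp Require Import all_classical all_reals all_analysis.
Unset Printing Implicit Defensive.
Import Order.TTheory GRing.Theory Num.Theory numFieldNormedType.Exports.
Local Open Scope classical_set_scope.
Local Open Scope ring_scope.

Section Defs.
Context {R : realType}.

Definition sub (X : set R) := {x : R | X x}.

Definition sub_open (X : set R) (A : set (sub X)) : Prop :=
  exists U : set R, open U /\ A = (@proj1_sig R X) @^-1` U.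
Definition sub_closed (X : set R) (A : set (sub X)) : Prop :=
  exists C : set R, closed C /\ A = (@proj1_sig R X) @^-1` C.

Definition sub_Borel (X : set R) : set (set (sub X)) :=
  <<s setT, sub_open X >>.

Definition sub_continuous (X : set R) (f : sub X -> R) : Prop :=
  forall U : set R, open U -> sub_open X (f @^-1` U).

Definition Borel_fun (X : set R) (f : sub X -> R) : Prop :=
  forall U : set R, open U -> sub_Borel X (f @^-1` U).

Definition ptws_cvg (X : set R) (g : nat -> sub X -> R) (f : sub X -> R) : Prop :=
  forall x : sub X, (fun n => g n x) @ \oo --> f x.

Definition Baire1_fun (X : set R) (f : sub X -> R) : Prop :=
  exists g : nat -> sub X -> R,
    (forall n, sub_continuous X (g n)) /\ ptws_cvg X g f.

Definition BX (X : set R) : set (sub X -> R) := [set f | Borel_fun X f].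
Definition B1X (X : set R) : set (sub X -> R) := [set f | Baire1_fun X f].

Definition gamma_cover (X : set R) (U : set (set (sub X))) : Prop :=
  infinite_set U /\
  (\bigcup_(A in U) A = setT) /\
  (forall x : sub X, finite_set [set A | U A /\ ~ A x]).

Definition B_Gamma (X : set R) : set (set (set (sub X))) :=
  [set U | countable U /\ gamma_cover X U /\ U `<=` sub_Borel X].
Definition F_Gamma (X : set R) : set (set (set (sub X))) :=
  [set U | countable U /\ gamma_cover X U /\ U `<=` sub_closed X].

Definition seq_dense (X : set R) (Y D : set (sub X -> R)) : Prop :=
  D `<=` Y /\
  forall f, Y f -> exists g : nat -> sub X -> R, (forall n, D (g n)) /\ ptws_cvg X g f.

Definition SeqDense (X : set R) (Y : set (sub X -> R)) : set (set (sub X -> R)) :=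
  [set D | countable D /\ seq_dense X Y D].

Definition seq_separable (X : set R) (Y : set (sub X -> R)) : Prop :=
  exists D, SeqDense X Y D.

End Defs.

Definition S1 {T : Type} (A B : set (set T)) : Prop :=
  forall An : nat -> set T, (forall n, A (An n)) ->
    exists b : nat -> T, (forall n, An n (b n)) /\ B (range b).

Definition Sfin {T : Type} (A B : set (set T)) : Prop :=
  forall An : nat -> set T, (forall n, A (An n)) ->
    exists Bn : nat -> set T,
      (forall n, finite_set (Bn n) /\ Bn n `<=` An n) /\
      B (\bigcup_n Bn n).

(* Main.v *)
Require Import Defs.
From mathcomp Require Import all_boot all_order all_algebra.
From mathcomp Require Import all_classical all_reals all_analysis.
From mathcomp Require Import ring lra.
Import Order.TTheory GRing.Theory Num.Theory numFieldNormedType.Exports.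
Local Open Scope classical_set_scope.

(** All seven properties are equivalent to a single domination principle: given
    countably many increasing sequences of closed sets, each covering [X], one
    can pick one set from each sequence so that every point of [X] lies in all
    but finitely many of the chosen sets.

    Applied to closed sets approximating a set and its complement, domination
    shows that countable intersections of sets that are both F_sigma and G_delta
    are F_sigma; hence all Borel sets are F_sigma, domination extends to Borel
    sets, and [B(X) = B_1(X)]. By a greedy form of the Lebesgue-Hausdorff theorem,
    [B_1(X)] is sequentially separable for every [X]: a countable set of
    piecewise linear functions approximates every function whose preimages of
    open sets are F_sigma. Domination also lets one diagonalise iterated
    pointwise limits of Borel functions, which yields the S_1 selections.

    Conversely, S_fin on covers gives domination by selecting sets that occur at
    arbitrarily late stages, and S_fin on sequentially dense sets gives it by
    replacing each member [d] of a dense sequence by the function equal to [d] on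
    the given closed set and to 2 off it, then looking at a sequence that converges
    to a constant function which was never selected. *)

(** * Finite and countable sets, selection principles and domination *)

Lemma near_finite_set (T I : Type) (F : set_system I) (S : set T)
    (P : T -> I -> Prop) :
  Filter F -> finite_set S -> (forall s, S s -> \forall i \near F, P s i) ->
  \forall i \near F, forall s, S s -> P s i.
Proof.
elim/Pchoice: T => T in S P * => FF /finite_seqP[s ->] {S} sP.
elim: s sP => [|a s IHs] sP; first by apply: nearW => i t; rewrite /= in_nil.
have Pa : \forall i \near F, P a i by apply: sP; rewrite /= mem_head.
have {}/IHs Ps : forall t, [set` s] t -> \forall i \near F, P t i.
  by move=> t /= ts; apply: sP; rewrite /= in_cons ts orbT.
near=> i => t; rewrite /= in_cons => /orP[/eqP ->|ts]; first by near: i.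
by move: t ts; near: i; exact: Ps.
Unshelve. all: by end_near. Qed.

Lemma countable_range_countType (I : countType) (T : Type) (f : I -> T) :
  countable (range f).
Proof. exact/(sub_countable (card_image_le _ _))/countableP. Qed.

Lemma countable_enum (T : Type) (D : set T) : countable D -> D !=set0 ->
  exists d : nat -> T, range d = D.
Proof.
move=> /pfcard_geP[->|[f]] D0; first by have := D0 => -[].
by exists f; exact: image_eq.
Qed.

Lemma countable_infinite_enum (T : Type) (U : set T) :
  countable U -> infinite_set U ->
  exists e : nat -> T, injective e /\ range e = U.
Proof.
elim/Ppointed: T => T in U *; first by rewrite emptyE => _ /infinite_setN0[].
move=> cU iU; have /card_esym /pcard_eqP/bijPex[e [eU einj esurj]] :=
  eq_card_nat cU iU.
exists e; split; first by move=> i j eij; apply: einj; rewrite ?inE.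
by apply/seteqP; split=> [_ [n _ <-]|x /esurj//]; exact: eU.
Qed.

(** Otherwise the unit interval would be countable, yet its Lebesgue measure is 1. *)
Lemma countable_avoid (R : realType) (V : set R) : countable V -> exists c, ~ V c.
Proof.
move=> cV; apply/existsNP => VT.
have c01 : countable `[0%R : R, 1%R].
  by apply: (sub_countable (subset_card_le _) cV) => x _; exact: contrapT (VT x).
have := countable_lebesgue_measure0 c01.
by rewrite lebesgue_measure_itv/= lte01 sube0 => -[/eqP]; rewrite oner_eq0.
Qed.

Lemma S1_Sfin (T : Type) (A B : set (set T)) : S1 A B -> Sfin A B.
Proof.
move=> s1 An AAn; have [b [Ab Bb]] := s1 An AAn.
exists (fun n => [set b n]); split=> [n|].
  by split; [exact: finite_set1|move=> _ ->].
suff -> : \bigcup_n [set b n] = range b by [].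
by apply/seteqP; split=> [t [n _ ->]|t [n _ <-]]; exists n.
Qed.

(* For Borel sets this says that every Borel map into the Baire space is
   eventually dominated by a single sequence: [A n k] plays the role of
   [{x | h x n <= k}]. *)
Definition domination {T : Type} (C : set (set T)) : Prop :=
  forall A : nat -> nat -> set T,
    (forall n k, C (A n k)) ->
    (forall n, nondecreasing_seq (A n)) ->
    (forall n x, exists k, A n k x) ->
    exists kappa : nat -> nat, forall x, \forall n \near \oo, A n (kappa n) x.

(** Replacing [A n k] by the intersection of the [A m k] with [m <= n] makes the sets decrease in
    [n]; a set selected at a late stage then serves at every earlier one. *)
Lemma domination_nonincreasing (T : Type) (C : set (set T)) :
  setI_closed C ->
  (forall A : nat -> nat -> set T,
    (forall n k, C (A n k)) ->
    (forall n, nondecreasing_seq (A n)) ->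
    (forall m n k, (m <= n)%N -> A n k `<=` A m k) ->
    (forall n x, exists k, A n k x) ->
    exists kappa : nat -> nat, forall x, \forall n \near \oo, A n (kappa n) x) ->
  domination C.
Proof.
move=> CI dom A CA ndA covA.
pose B := fix B n k := if n is m.+1 then A n k `&` B m k else A 0%N k.
have BA n k : B n k `<=` A n k by case: n => [//|n] x [].
have CB n k : C (B n k) by elim: n => [|n IHn] //=; apply: CI.
have ndB n : nondecreasing_seq (B n).
  move=> i j ij; apply/subsetPset; elim: n => [|n IHn] /=.
    exact/subsetPset/ndA.
  by apply: setISS => //; exact/subsetPset/ndA.
have niB m n k : (m <= n)%N -> B n k `<=` B m k.
  elim: n => [|n IHn]; first by rewrite leqn0 => /eqP ->.
  by rewrite leq_eqVlt => /predU1P[-> //|/IHn BB] x [_ /BB].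
have covB n x : exists k, B n k x.
  elim: n => [|n [k Bk]]; first exact: covA.
  have [l Al] := covA n.+1 x; exists (maxn k l); split.
    by move: Al; apply/subsetPset/ndA/leq_maxr.
  by move: Bk; apply/subsetPset/ndB/leq_maxl.
have [kappa kP] := dom B CB ndB niB covB.
by exists kappa => x; apply: filterS (kP x) => n; exact: BA.
Qed.

(** * Gamma-covers and domination *)

Section GammaCovers.
Context {R : realType} (X : set R).

(** [B_Gamma X] and [F_Gamma X] are the instances for Borel and for closed sets, by unfolding. *)
Definition Gamma (C : set (set (sub X))) : set (set (set (sub X))) :=
  [set U | countable U /\ gamma_cover X U /\ U `<=` C].

Lemma Sfin_Gamma_domination (C : set (set (sub X))) :
  setI_closed C -> Sfin (Gamma C) (Gamma C) -> domination C.
Proof.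
move=> CI sfin; apply: domination_nonincreasing => // A CA ndA niA covA.
(* If every row contains the whole space, select it. Otherwise row [n0] does not, and by
   monotonicity no later row does; this makes those rows infinite families, as a gamma-cover must
   be. *)
have [Atriv|/existsNP[n0 /forallNP An0]] :=
    pselect (forall n, exists k, A n k = setT).
  have [kappa kP] := choice Atriv.
  by exists kappa => x; apply: nearW => n; rewrite kP.
have GA n : Gamma C (range (A (n0 + n)%N)).
  split; first exact: countable_range_countType.
  split; last by move=> _ [k _ <-].
  have bad x : finite_set [set B | range (A (n0 + n)%N) B /\ ~ B x].
    have [k0 Ak0] := covA (n0 + n)%N x.
    apply: (@sub_finite_set _ _ (A (n0 + n)%N @` `I_k0)).
      move=> _ [[k _ <-] nAk]; exists k => //=; rewrite ltnNge; apply/negP.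
      by move=> k0k; apply: nAk; move: Ak0; apply/subsetPset/ndA.
    exact/finite_image/finite_II.
  split; last split=> //.
    move=> finA.
    have [k _ kP] : \forall k \near \oo, forall B, range (A (n0 + n)%N) B ->
        B `<=` A (n0 + n)%N k.
      apply: near_finite_set => // _ [i _ <-]; exists i => // j /= ij.
      exact/subsetPset/ndA.
    apply: (An0 k); rewrite -subTset => x _.
    have [i Ai] := covA (n0 + n)%N x.
    apply: (niA n0 (n0 + n)%N k (leq_addr _ _)).
    by apply: (kP k (leqnn k) (A (n0 + n)%N i)) => //; exists i.
  rewrite -subTset => x _; have [k Ak] := covA (n0 + n)%N x.
  by exists (A (n0 + n)%N k) => //; exists k.
have [F [FP [_ [[infF [_ badF]] _]]]] := sfin _ GA.
(* Sets chosen at arbitrarily late stages exist because each stage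
   contributes only finitely many sets. *)
have late m : exists Wk : set (sub X) * nat,
    [/\ (\bigcup_n F n) Wk.1, forall n, (n < m)%N -> ~ F n Wk.1 &
        Wk.1 `<=` A m Wk.2].
  have : infinite_set (\bigcup_n F n `\` \bigcup_(n in `I_m) F n).
    apply: infinite_setD => //; apply: bigcup_finite => // n _.
    by have [] := FP n.
  move=> /infinite_setN0[W [[n _ FW] nW]].
  have nFW i : (i < m)%N -> ~ F i W by move=> im Fi; apply: nW; exists i.
  have [_ /(_ _ FW)[k _ AW]] := FP n.
  exists (W, k); split => //=; first by exists n.
  rewrite -AW; apply: niA.
  have mn : (m <= n)%N by rewrite leqNgt; apply/negP => /nFW.
  by rewrite (leq_trans mn) ?leq_addl.
have [w wP] := choice late.
exists (fun m => (w m).2) => x.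
(* A set in [F n] differs from every [(w m).1] with [m > n], so the finitely many selected sets
   missing [x] are eventually avoided. *)
have : \forall m \near \oo, forall B, [set B | (\bigcup_n F n) B /\ ~ B x] B ->
    (w m).1 <> B.
  apply: near_finite_set => // B [[n _ FB] _]; exists n.+1 => // m /= nm wB.
  by have [_ /(_ n nm)] := wP m; rewrite wB.
apply: filterS => m wm; have [Fw _ wA] := wP m; apply: wA.
by apply: contrapT => nw; apply: (wm (w m).1).
Qed.

(** Domination is applied to the tail intersections of an enumeration of each cover. Every member of
    index at least [kappa n] contains [A n (kappa n)], which leaves infinitely many candidates at
    each stage, enough to keep the choices distinct and the new cover infinite. *)
Lemma domination_S1_Gamma (C : set (set (sub X))) :
  (forall A : nat -> set (sub X), (forall n, C (A n)) -> C (\bigcap_n A n)) ->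
  domination C -> S1 (Gamma C) (Gamma C).
Proof.
move=> CI dom U GU.
have /choice[e eP] n : exists e : nat -> set (sub X),
    injective e /\ range e = U n.
  by have [cU [[iU _] _]] := GU n; exact: countable_infinite_enum.
have Ue n k : U n (e n k) by have [_ <-] := eP n; exists k.
pose A n k := \bigcap_i e n (k + i)%N.
have [||n x|kappa kP] := dom A.
- by move=> n k; apply: CI => i; have [_ [_ UC]] := GU n; exact: UC.
- move=> n i j ij; apply/subsetPset => x Ax l _.
  by have := Ax (j - i + l)%N I; rewrite addnA subnKC.
- have [_ [[_ [_ fin]] _]] := GU n.
  have : \forall k \near \oo, forall B, [set B | U n B /\ ~ B x] B -> e n k <> B.
    apply: near_finite_set => // B [UB _].
    have [einj] := eP n; move: UB => /[swap] <- [i _ <-].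
    by exists i.+1 => // j /= ij /einj ji; rewrite ji ltnn in ij.
  move=> [k _ kP]; exists k => i _; apply: contrapT => nB.
  exact: (kP (k + i)%N (leq_addr _ _) (e n (k + i)%N)).
(* [c] avoids a finite set [S] of earlier choices. For infinite [S] it returns a default, which
   never occurs because every history [h n] is finite. *)
have /choice[c cP] nS : exists B, U nS.1 B /\
    (finite_set nS.2 -> ~ nS.2 B /\ A nS.1 (kappa nS.1) `<=` B).
  case: nS => n S /=.
  have [finS|] := pselect (finite_set S); last first.
    by move=> nf; exists (e n 0%N).
  have [i nSi] : exists i, ~ S (e n (kappa n + i)%N).
    apply: contrapT => /forallNP SS; apply: infinite_nat.
    apply: (@sub_finite_set _ _ ((fun i => e n (kappa n + i)%N) @^-1` S)).
      by move=> i _ /=; apply: contrapT; exact: SS.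
    apply: finite_preimage => // i j _ _ eij.
    by have [/(_ _ _ eij)/addnI] := eP n.
  by exists (e n (kappa n + i)%N); split => // _; split => // x; apply.
pose h := fix h n := if n is m.+1 then c (m, h m) |` h m else set0.
have hfin n : finite_set (h n).
  by elim: n => [|n IHn] //=; rewrite finite_setU; split => //.
pose b n := c (n, h n).
have bh m n : (m < n)%N -> h n (b m).
  elim: n => // n IHn; rewrite ltnS leq_eqVlt => /predU1P[->|/IHn]; first by left.
  by right.
have Ub n : U n (b n) by have [] := cP (n, h n).
have bnh n : ~ h n (b n) by have [_ /(_ (hfin n))[]] := cP (n, h n).
have Ab n : A n (kappa n) `<=` b n by have [_ /(_ (hfin n))[]] := cP (n, h n).
have binj : injective b.
  move=> i j bij; case: (ltngtP i j) => // /bh; first by rewrite bij => /bnh.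
  by rewrite -bij => /bnh.
exists b; split => //; split; first exact: countable_range_countType.
split; last first.
  by move=> _ [n _ <-]; have [_ [_ UC]] := GU n; exact: UC.
split.
  move=> fb; apply: infinite_nat.
  by rewrite -(preimage_range b); apply: finite_preimage => // i j _ _ /binj.
split; first rewrite -subTset => x _.
  by have [N _ /(_ _ (leqnn N)) AN] := kP x; exists (b N) => //; exact: Ab.
move=> x; have [N _ NP] := kP x.
apply: (@sub_finite_set _ _ (b @` `I_N)); last exact/finite_image/finite_II.
move=> _ [[n _ <-] nb]; exists n => //=; rewrite ltnNge; apply/negP => Nn.
by apply: nb; apply: Ab; exact: NP.
Qed.

End GammaCovers.

(** * Closed and Borel subsets of a subspace of the line *)

Section SubspaceOfReals.
Context {R : realType} (X : set R).
Implicit Types (A B : set (sub X)) (U : set R).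
Local Notation Borel := (sub_Borel X).
Local Notation closed_in := (sub_closed X).

Lemma sub_openC A : sub_open X A -> closed_in (~` A).
Proof. by move=> [U [oU ->]]; exists (~` U); split => //; exact: open_closedC. Qed.

Lemma sub_closedC A : closed_in A -> sub_open X (~` A).
Proof. by move=> [U [oU ->]]; exists (~` U); split => //; exact: closed_openC. Qed.

Lemma sub_closed0 : closed_in set0.
Proof. by exists set0; split; [exact: closed0|]. Qed.

Lemma sub_closedT : closed_in setT.
Proof. by exists setT; split; [exact: closedT|]. Qed.

Lemma sub_closed_bigcap (J : Type) (A : J -> set (sub X)) :
  (forall i, closed_in (A i)) -> closed_in (\bigcap_i A i).
Proof.
move=> /choice[C AC]; exists (\bigcap_i C i); split.
  by apply: closed_bigI => i _; have [] := AC i.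
by rewrite preimage_bigcap; apply: eq_bigcapr => i _; have [] := AC i.
Qed.

Lemma sub_closedI : setI_closed closed_in.
Proof.
move=> _ _ [C [cC ->]] [D [cD ->]].
by exists (C `&` D); split => //; exact: closedI.
Qed.

Lemma sub_closedU A B : closed_in A -> closed_in B -> closed_in (A `|` B).
Proof.
move=> [C [cC ->]] [D [cD ->]].
by exists (C `|` D); split => //; exact: closedU.
Qed.

Lemma sub_closed_bigcup_lt (A : nat -> set (sub X)) n :
  (forall i, closed_in (A i)) -> closed_in (\bigcup_(i < n) A i).
Proof.
move=> cA; rewrite bigcup_mkord; elim: n => [|n IHn].
  by rewrite big_ord0; exact: sub_closed0.
by rewrite big_ord_recr/=; exact: sub_closedU.
Qed.

Lemma Borel_open A : sub_open X A -> Borel A.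
Proof. by move=> oA; apply: sub_sigma_algebra. Qed.

Lemma BorelC A : Borel A -> Borel (~` A).
Proof. by rewrite -setTD; exact: sigma_algebraCD. Qed.

Lemma Borel_closed A : closed_in A -> Borel A.
Proof. by move=> /sub_closedC/Borel_open/BorelC; rewrite setCK. Qed.

Lemma Borel_bigcup (I : countType) (A : I -> set (sub X)) :
  (forall i, Borel (A i)) -> Borel (\bigcup_i A i).
Proof.
move=> BA.
rewrite (_ : \bigcup_i A i =
  \bigcup_n (if unpickle n is Some i then A i else set0)).
  have B0 : Borel set0 by apply: Borel_closed; exact: sub_closed0.
  by apply: sigma_algebra_bigcup => n; case: (unpickle n).
apply/seteqP; split=> [x [i _ Ai]|x [n _]].
  by exists (pickle i) => //; rewrite pickleK.
by case: unpickle => // i Ai; exists i.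
Qed.

Lemma Borel_bigcap (I : countType) (A : I -> set (sub X)) :
  (forall i, Borel (A i)) -> Borel (\bigcap_i A i).
Proof.
move=> BA; rewrite -[X in Borel X]setCK setC_bigcap; apply: BorelC.
by apply: Borel_bigcup => i; exact: BorelC.
Qed.

Lemma BorelI : setI_closed Borel.
Proof.
move=> A B BA BB; rewrite -bigcap2E; apply: Borel_bigcap => -[|[|n]] //.
apply: Borel_closed; exact: sub_closedT.
Qed.

Lemma BorelU A B : Borel A -> Borel B -> Borel (A `|` B).
Proof.
move=> BA BB; rewrite -[A `|` B]setCK setCU; apply: BorelC.
by apply: BorelI; exact: BorelC.
Qed.

(** * F_sigma sets, and the collapse of the Borel hierarchy under domination *)

Definition Fsigma A : Prop :=
  exists C : nat -> set (sub X), (forall n, closed_in (C n)) /\ A = \bigcup_n C n.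

Lemma Fsigma_bigcup_closed (I : countType) (C : I -> set (sub X)) :
  (forall i, closed_in (C i)) -> Fsigma (\bigcup_i C i).
Proof.
move=> cC; exists (fun n => if unpickle n is Some i then C i else set0); split.
  by move=> n; case: (unpickle n) => [i|]; [exact: cC|exact: sub_closed0].
apply/seteqP; split=> [x [i _ Ai]|x [n _]].
  by exists (pickle i) => //; rewrite pickleK.
by case: unpickle => // i Ai; exists i.
Qed.

Lemma Fsigma_closed A : closed_in A -> Fsigma A.
Proof. by move=> cA; exists (fun=> A); split => //; rewrite bigcup_const. Qed.

Lemma Fsigma_bigcup (I : countType) (A : I -> set (sub X)) :
  (forall i, Fsigma (A i)) -> Fsigma (\bigcup_i A i).
Proof.
move=> /choice[C AC].
rewrite (_ : \bigcup_i A i = \bigcup_(p : I * nat) C p.1 p.2).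
  by apply: Fsigma_bigcup_closed => -[i n] /=; have [] := AC i.
apply/seteqP; split=> [x [i _]|x [[i n] _ /= Cin]].
  by have [_ ->] := AC i => -[n _ Cin]; exists (i, n).
by exists i => //; have [_ ->] := AC i; exists n.
Qed.

Lemma FsigmaI : setI_closed Fsigma.
Proof.
move=> _ _ [C [cC ->]] [D [cD ->]].
rewrite (_ : _ `&` _ = \bigcup_(p : nat * nat) (C p.1 `&` D p.2)).
  by apply: Fsigma_bigcup_closed => p; exact: sub_closedI.
apply/seteqP; split=> [x [[i _ Ci] [j _ Dj]]|x [[i j] _ [Ci Dj]]].
  by exists (i, j).
by split; [exists i|exists j].
Qed.

Lemma FsigmaU A B : Fsigma A -> Fsigma B -> Fsigma (A `|` B).
Proof.
move=> FA FB; rewrite (_ : A `|` B = \bigcup_b if b then A else B).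
  by apply: Fsigma_bigcup; case.
by apply/seteqP; split=> [x [|]|x [[] _]]; [exists true|exists false|left|right].
Qed.

Lemma Fsigma_nondecreasing A : Fsigma A ->
  exists C : nat -> set (sub X), [/\ forall n, closed_in (C n),
    nondecreasing_seq C & A = \bigcup_n C n].
Proof.
move=> [C [cC ->]]; exists (fun n => \bigcup_(i < n) C i); split.
- by move=> n; exact: sub_closed_bigcup_lt.
- move=> m n mn; apply/subsetPset => x [i /= im Ci].
  by exists i => //=; exact: leq_trans mn.
- apply/seteqP; split=> [x [i _ Ci]|x [n _ [i _ Ci]]]; last by exists i.
  by exists i.+1 => //; exists i => /=.
Qed.

(* Unlike an exhaustion by closed sets, this also controls limits: a sequence
   converging to a point of [U] eventually stays in one of the intervals. *)
Lemma open_rat_itv (U : set R) (z : R) : open U -> U z ->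
  exists p : rat * rat, `[ratr p.1, ratr p.2]%classic `<=` U /\
    nbhs z `[ratr p.1 : R, ratr p.2]%classic.
Proof.
move=> oU Uz; have /nbhs_ballP[e /= e0 zeU] := open_nbhs_nbhs (conj oU Uz).
have [p] : exists p : rat, ratr p \in `]z - e, z[%R.
  by apply: rat_in_itvoo; lra.
have [q] : exists q : rat, ratr q \in `]z, z + e[%R.
  by apply: rat_in_itvoo; lra.
rewrite !in_itv/= => /andP[zq qz] /andP[zp pz]; exists (p, q); split => /=.
  move=> y /=; rewrite in_itv/= => /andP[py yq]; apply: zeU.
  by rewrite /ball/= ltr_norml; apply/andP; split; lra.
apply: filterS (@near_in_itvoo _ (ratr p) (ratr q) z _).
  by move=> y; exact: subset_itv_oo_cc.
by rewrite in_itv/= pz zq.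
Qed.

(** The inclusion sits inside the set, which is thus empty for intervals not contained in [U]; all
    rational pairs can then index a union of closed sets. *)
Definition clip_itv (U : set R) (p : rat * rat) : set R :=
  [set z | `[ratr p.1, ratr p.2]%classic `<=` U /\ ratr p.1 <= z <= ratr p.2]%R.

Lemma closed_clip_itv U p : closed (clip_itv U p).
Proof.
have [pU|npU] := pselect (`[ratr p.1, ratr p.2]%classic `<=` U); last first.
  have -> : clip_itv U p = set0 by apply/seteqP; split=> z // [].
  exact: closed0.
rewrite (_ : clip_itv U p = `[ratr p.1, ratr p.2]%classic).
  exact: interval_closed.
by apply/seteqP; split=> [z [_]|z]; rewrite /= in_itv.
Qed.

Lemma open_clip_itv U : open U -> U = \bigcup_p clip_itv U p.
Proof.
move=> oU; apply/seteqP; split=> [z Uz|z [p _ [pU pz]]].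
  have [p [pU /nbhs_singleton]] := open_rat_itv _ _ oU Uz.
  by exists p => //; split.
by apply: pU; rewrite /= in_itv.
Qed.

Lemma Fsigma_open A : sub_open X A -> Fsigma A.
Proof.
move=> [U [oU ->]]; rewrite [in X in Fsigma X](open_clip_itv _ oU) preimage_bigcup.
apply: Fsigma_bigcup_closed => p; exists (clip_itv U p); split => //.
exact: closed_clip_itv.
Qed.

Lemma Fsigma_Borel A : Fsigma A -> Borel A.
Proof.
by move=> [C [cC ->]]; apply: Borel_bigcup => n; exact: Borel_closed.
Qed.

(** A point common to all [A n] is in no [H n k], so domination of the sets [C n k] united with
    [H n k] places it in [C n (kappa n)] for almost all [n]. *)
Lemma domination_Fsigma_bigcap : domination closed_in ->
  forall A : nat -> set (sub X), (forall n, Fsigma (A n)) ->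
    (forall n, Fsigma (~` A n)) -> Fsigma (\bigcap_n A n).
Proof.
move=> dom A FA FAC.
have /choice[C CP] n := Fsigma_nondecreasing _ (FA n).
have /choice[H HP] n := Fsigma_nondecreasing _ (FAC n).
have ndC n : nondecreasing_seq (C n) by have [] := CP n.
have AE n : A n = \bigcup_k C n k by have [] := CP n.
have AEC n : ~` A n = \bigcup_k H n k by have [] := HP n.
have [||n x|kappa kP] := dom (fun n k => C n k `|` H n k).
- by move=> n k; apply: sub_closedU; [have [] := CP n|have [] := HP n].
- move=> n i j ij; apply/subsetPset; apply: setUSS; apply/subsetPset.
    exact: ndC.
  by have [_ ndH _] := HP n; exact: ndH.
- have [|] := pselect (A n x); first by rewrite AE => -[k _ Ck]; exists k; left.
  by move=> nA; have : (~` A n) x by []; rewrite AEC => -[k _ Hk]; exists k; right.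
(* With [p = (N, K)], stages from [N] on use [kappa]; the finitely many earlier ones share the index
   [K], as the [C n] increase. *)
pose E (p : nat * nat) := \bigcap_n C n (if (p.1 <= n)%N then kappa n else p.2).
rewrite (_ : \bigcap_n A n = \bigcup_p E p).
  apply: Fsigma_bigcup_closed => p; apply: sub_closed_bigcap => n.
  by have [] := CP n.
apply/seteqP; split=> [x Ax|x [p _ Ep] n _]; last first.
  by rewrite AE; exists (if (p.1 <= n)%N then kappa n else p.2); last exact: Ep.
have [N _ NP] := kP x.
have [K _ KP] : \forall k \near \oo, forall n, `I_N n -> C n k x.
  apply: near_finite_set => // n _; have := Ax n I; rewrite AE => -[k _ Ck].
  by exists k => // l /= kl; move: Ck; apply/subsetPset/ndC.
exists (N, K) => // n _ /=; case: leqP => [Nn|nN]; last exact: (KP K (leqnn K) n nN).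
have [//|Hn] := NP n Nn; have : (~` A n) x by rewrite AEC; exists (kappa n).
by move=> /(_ (Ax n I)).
Qed.

(** The sets that are F_sigma together with their complements form a sigma-algebra: for countable
    unions, the complement is an intersection of the kind just treated. *)
Lemma domination_Borel_Fsigma :
  domination closed_in -> Borel `<=` Fsigma.
Proof.
move=> dom; suff : Borel `<=` [set A | Fsigma A /\ Fsigma (~` A)].
  by move=> sub A /sub[].
apply: smallest_sub; last first.
  move=> A oA; split; first exact: Fsigma_open.
  exact/Fsigma_closed/sub_openC.
split=> [|A [FA FAC]|A FA] /=.
- by split; apply: Fsigma_closed; rewrite ?setC0; [exact: sub_closed0|exact: sub_closedT].
- by rewrite setTD setCK.
- split; first by apply: Fsigma_bigcup => n; have [] := FA n.
  rewrite setC_bigcup; apply: domination_Fsigma_bigcap => // n.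
    by have [] := FA n.
  by rewrite setCK; have [] := FA n.
Qed.

(** With each [A n i] an increasing union of closed sets [C (n, i) k], the diagonal unions over
    [i < k] of [C (n, i) k] are closed, increase to the whole space and lie in [A n k]. *)
Lemma domination_Borel : domination closed_in -> domination Borel.
Proof.
move=> dom A BA ndA covA.
have /choice[C CP] (p : nat * nat) : exists C : nat -> set (sub X),
    [/\ forall n, closed_in (C n), nondecreasing_seq C & A p.1 p.2 = \bigcup_n C n].
  by apply/Fsigma_nondecreasing/domination_Borel_Fsigma.
have [||n x|kappa kP] := dom (fun n k => \bigcup_(i < k) C (n, i) k).
- by move=> n k; apply: sub_closed_bigcup_lt => i; have [] := CP (n, i).
- move=> n k l kl; apply/subsetPset => x [i /= ik Ci].
  exists i; first exact: leq_trans kl.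
  by move: Ci; apply/subsetPset; have [_ + _] := CP (n, i); apply.
- have [i Ai] := covA n x; have [_ ndC /= AE] := CP (n, i).
  move: Ai; rewrite AE => -[j _ Cj]; exists (maxn i.+1 j); exists i.
    by rewrite /= leq_max leqnn.
  by move: Cj; apply/subsetPset/ndC/leq_maxr.
exists kappa => x; apply: filterS (kP x) => n [i /= ik Ci].
have [_ _ /= AE] := CP (n, i).
have : A n i x by rewrite AE; exists (kappa n).
by apply/subsetPset/ndA/ltnW.
Qed.

End SubspaceOfReals.

(** * Greedy refinement of a set by a sequence of sets *)

Section Greedy.
Context {T : Type} (K : nat -> set T) (P : set T).

Fixpoint greedy (k : nat) : set T :=
  if k is j.+1 then
    if pselect (greedy j `&` K j !=set0) is left _ then greedy j `&` K j
    else greedy j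
  else P.

Lemma greedy_neq0 k : P !=set0 -> greedy k !=set0.
Proof. by move=> P0; elim: k => [|k IHk] //=; case: pselect. Qed.

Lemma greedy_nonincreasing i k : (i <= k)%N -> greedy k `<=` greedy i.
Proof.
elim: k => [|k IHk]; first by rewrite leqn0 => /eqP ->.
rewrite leq_eqVlt => /predU1P[-> //|/IHk sub] /=.
by case: pselect => // _ x [/sub].
Qed.

(* Earlier sets not containing [x] do not meet [P], so they cannot steer the
   greedy choice away from the sets containing [x]. *)
Lemma greedy_sub k j x : P x -> K j x -> (j < k)%N ->
  (forall i, (i < j)%N -> K i x \/ P `&` K i = set0) ->
  greedy k `<=` K j.
Proof.
move=> Px Kjx jk sep.
have gx i : (i <= j)%N -> greedy i x.
  elim: i => [//|i IHi] ij /=; have gi := IHi (ltnW ij).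
  case: pselect => // -[y [gy Ky]]; split => //.
  case: (sep i ij) => // PK0.
  suff : (P `&` K i) y by rewrite PK0.
  by split => //; exact: (@greedy_nonincreasing 0 i).
apply: (subset_trans (greedy_nonincreasing _ _ jk)) => /=.
case: pselect => [gK|[]]; first exact: subIsetr.
by exists x; split => //; exact: gx.
Qed.

End Greedy.

(** * Piecewise linear interpolation *)

Section TentInterpolation.
Context {R : realType}.
Local Open Scope ring_scope.

Definition tent (t : R) : R := Num.max 0 (1 - `|t|).

(** This is the function, linear between consecutive integers, with value [s_i] at each integer [i]
    indexing the list and 0 at all other integers. *)
Fixpoint interp (s : seq rat) (t : R) : R :=
  if s is a :: s' then ratr a * tent t + interp s' (t - 1) else 0.

Lemma tent_continuous : continuous tent.
Proof.
move=> t; apply: (@continuous_max _ _ (cst 0) (fun u => 1 - `|u|)).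
  exact: cst_continuous.
apply: cvgB; [exact: cvg_cst|exact: norm_continuous].
Qed.

Lemma interp_continuous s : continuous (interp s).
Proof.
elim: s => [|a s IHs] t /=; first exact: cst_continuous.
apply: cvgD; first by apply: cvgM; [exact: cvg_cst|exact: tent_continuous].
apply: (@cvg_comp _ _ _ (fun u => u - 1) (interp s) _ (nbhs (t - 1))).
  by apply: cvgB; [exact: cvg_id|exact: cvg_cst].
exact: IHs.
Qed.

Lemma tent_eq0 t : 1 <= `|t| -> tent t = 0.
Proof. by move=> t1; apply: max_l; lra. Qed.

Lemma interp_eq0 s t : t <= -1 -> interp s t = 0.
Proof.
elim: s t => [//|a s IHs] t t1 /=; rewrite tent_eq0; last by rewrite ler0_norm; lra.
by rewrite IHs ?mulr0 ?addr0//; lra.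
Qed.

(** Between two nodes only the two adjacent tents contribute, with weights adding to 1, so the
    interpolant is a convex combination of the two nodal values. *)
Lemma interp_near s j t (c e : R) : j%:R <= t <= j.+1%:R -> (j.+1 < size s)%N ->
  `|c - ratr s`_j| <= e -> `|c - ratr s`_j.+1| <= e -> `|c - interp s t| <= e.
Proof.
elim: j s t => [|j IHj] [//|a s] t /andP[jt tj] /= js.
  case: s js => [//|b s] _ /=; rewrite interp_eq0; last lra.
  have -> : tent t = 1 - t by rewrite /tent ger0_norm// max_r//; lra.
  have -> : tent (t - 1) = t.
    by rewrite /tent ler0_norm ?max_r; lra.
  move: (ratr a) (ratr b) => {}a {}b.
  rewrite !ler_norml => /andP[a1 a2] /andP[b1 b2]; apply/andP; split; nra.
move=> ce1 ce2; rewrite tent_eq0; last first.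
  by rewrite ger0_norm; move: (ler0n R j) jt; rewrite -natr1; lra.
rewrite mulr0 add0r; apply: (IHj s) => //.
by move: jt tj; rewrite -!natr1; lra.
Qed.

End TentInterpolation.

(** * The first Baire class and its sequential separability *)

Section BaireOne.
Context {R : realType} (X : set R).
Local Open Scope ring_scope.

(** Borel sets give [B(X)], and F_sigma sets give [B_1(X)] by [Baire1P]; this allows a common
    treatment of both spaces. *)
Definition preimages_in (C : set (set (sub X))) : set (sub X -> R) :=
  [set f | forall U, open U -> C (f @^-1` U)].

(** With [k = p.1], entry [i] of the list is placed at [-k + i/(k+1)]: as [k] grows the mesh tends
    to 0 and the grid starts ever further left. Rational entries keep the family countable. *)
Definition sub_interp (p : nat * seq rat) (x : sub X) : R :=
  interp p.2 (p.1.+1%:R * (sval x + p.1%:R)).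

Lemma sub_interp_continuous p : Defs.sub_continuous X (sub_interp p).
Proof.
move=> U oU; exists ((fun z => interp p.2 (p.1.+1%:R * (z + p.1%:R))) @^-1` U).
split=> //; apply: open_comp => // z _.
apply: (@cvg_comp _ _ _ (fun z => p.1.+1%:R * (z + p.1%:R)) (interp p.2) _
  (nbhs (p.1.+1%:R * (z + p.1%:R)))).
  by apply: cvgM; [exact: cvg_cst|apply: cvgD; [exact: cvg_id|exact: cvg_cst]].
exact: interp_continuous.
Qed.

(** The pieces are the closed sets composing the preimages of rational intervals; a rational
    interval around [f x] of length below [e] supplies the one required. *)
Lemma Fsigma_fun_pieces f : preimages_in (Fsigma X) f ->
  exists K : nat -> set (sub X), (forall j, sub_closed X (K j)) /\
    forall x e, 0 < e -> exists j, K j x /\ forall y, K j y -> `|f x - f y| < e.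
Proof.
move=> Ff.
have /choice[C CP] (p : rat * rat) : Fsigma X (f @^-1` `]ratr p.1, ratr p.2[).
  by apply: Ff; exact: interval_open.
exists (fun j => if unpickle j is Some (p, n) then C p n else set0); split.
  move=> j; case: (unpickle j) => [[p n]|]; last exact: sub_closed0.
  by have [] := CP p.
move=> x e e0.
have [p] : exists p : rat, ratr p \in `]f x - e / 2, f x[%R.
  by apply: rat_in_itvoo; lra.
have [q] : exists q : rat, ratr q \in `]f x, f x + e / 2[%R.
  by apply: rat_in_itvoo; lra.
rewrite !in_itv/= => /andP[xq qx] /andP[xp px].
have [_ fE] := CP (p, q).
have : (f @^-1` `]ratr p, ratr q[) x by rewrite /= in_itv/= px xq.
rewrite fE => -[n _ Cx]; exists (pickle ((p, q), n)); rewrite pickleK; split => //.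
move=> y Cy; have : (f @^-1` `]ratr p, ratr q[) y by rewrite fE; exists n.
by rewrite /= in_itv/= => /andP[py yq]; rewrite ltr_norml; apply/andP; split; lra.
Qed.

(* [f] is recovered from its values at one point of each of finitely many small
   cells; the point is chosen greedily so that, near any given [x], it lies in a
   closed piece through [x] on which [f] is almost constant. *)
Lemma interp_limit f : preimages_in (Fsigma X) f ->
  exists g : nat -> sub X -> R,
    (forall n, range sub_interp (g n)) /\ ptws_cvg X g f.
Proof.
move=> /Fsigma_fun_pieces[K [cK KP]].
pose scale k (x : sub X) : R := k.+1%:R * (sval x + k%:R).
pose cell k i : set (sub X) := [set y | `|scale k y - i%:R| <= 1].
(* [c (k, i)] approximates within [1/(k+1)] the value of [f] at a greedy point of the cell around
   node [i]; empty cells get 0. *)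
have /choice[c cP] (p : nat * nat) : exists q : rat, cell p.1 p.2 !=set0 ->
    exists y, greedy K (cell p.1 p.2) p.1 y /\ `|f y - ratr q| < p.1.+1%:R^-1.
  have [|] := pselect (cell p.1 p.2 !=set0); last by exists 0.
  move=> /(greedy_neq0 K _ p.1)[y gy].
  have : 0 < p.1.+1%:R^-1 :> R by rewrite invr_gt0.
  move: (p.1.+1%:R^-1 : R) => d d0.
  have [q] : exists q : rat, ratr q \in `]f y, f y + d[%R.
    by apply: rat_in_itvoo; lra.
  rewrite in_itv/= => /andP[yq qy]; exists q => _; exists y; split => //.
  by rewrite ltr_norml; apply/andP; split; lra.
(* For [|x| < k] the scaled position is between 0 and [(k+1)(k+k)]; two further entries ensure that
   both neighbouring nodes are in the list. *)
exists (fun k => sub_interp (k, mkseq (fun i => c (k, i)) (k.+1 * (k + k)).+2)).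
split=> [k|x]; first by eexists.
apply/cvgrPdist_le => e e0.
have e20 : 0 < e / 2 by lra.
have [j [Kjx Kj]] := KP x (e / 2) e20.
(* The finitely many pieces before [j] that miss [x] are closed, hence at positive distance from it,
   while points of one cell are at most [2/(k+1)] apart. *)
have sepj : \forall k \near \oo, forall i, `I_j i -> K i x \/
    (forall y, `|sval x - sval y| <= 2 * k.+1%:R^-1 -> ~ K i y).
  apply: near_finite_set => // i _.
  have [Kx|nKx] := pselect (K i x); first by apply: nearW => k; left.
  have [F [cF KF]] := cK i.
  have : nbhs (sval x) (~` F).
    by apply: open_nbhs_nbhs; split; [exact: closed_openC|rewrite KF in nKx].
  move=> /nbhs_ballP[d /= d0 dF].
  have d20 : 0 < d / 2 by lra.
  apply: filterS (near_infty_natSinv_lt (PosNum d20)) => k kd; right => y xy.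
  rewrite KF => Fy; apply: (dF (sval y)) => //=; rewrite /ball/=.
  apply: (le_lt_trans xy); rewrite mulrC -ltr_pdivlMr//; exact: kd.
near=> k.
have sep : forall i, `I_j i -> K i x \/
    (forall y, `|sval x - sval y| <= 2 * k.+1%:R^-1 -> ~ K i y).
  by near: k.
have ke : k.+1%:R^-1 < e / 2 by near: k; exact: (near_infty_natSinv_lt (PosNum e20)).
have jk : (j < k)%N by near: k; exact: nbhs_infty_gt.
have xk : `|sval x| < k%:R by near: k; exact: nbhs_infty_gtr.
have k0 : 0 < k.+1%:R :> R by [].
have cellP i : cell k i x -> `|f x - ratr (c (k, i))| <= e.
  move=> cx; have [|y [gy fy]] := cP (k, i); first by exists x.
  have dist z : cell k i z -> `|sval x - sval z| <= 2 * k.+1%:R^-1.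
    move=> cz; rewrite ler_pdivlMr// mulrC -[X in X * _]ger0_norm// -normrM.
    rewrite (_ : _ * _ = (scale k x - i%:R) - (scale k z - i%:R)).
      by rewrite (le_trans (ler_normB _ _))//; move: cx cz; rewrite /cell/=; lra.
    by rewrite /scale; ring.
  have /Kj fxy : K j y.
    apply: (greedy_sub K (cell k i) k j x) gy => // l lj.
    case: (sep l lj) => [|nK]; first by left.
    by right; apply/seteqP; split=> z // [/dist/nK].
  rewrite (_ : _ - _ = (f x - f y) + (f y - ratr (c (k, i)))); last by lra.
  by rewrite (le_trans (ler_normD _ _))//; have := lt_trans fy ke; lra.
have t0 : 0 <= scale k x.
  by apply: mulr_ge0 => //; move: xk; rewrite ltr_norml; lra.
have /andP[it ti] := truncn_itv t0; set i := Num.truncn (scale k x) in it ti.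
have ik : (i <= k.+1 * (k + k))%N.
  rewrite -(ler_nat R) (le_trans it)//.
  rewrite /scale natrM ler_wpM2l// natrD lerD2r.
  by move: xk; rewrite ltr_norml => /andP[_ /ltW].
rewrite /sub_interp; apply: (interp_near _ i).
- by rewrite it ltW.
- by rewrite size_mkseq !ltnS.
- rewrite nth_mkseq; last by rewrite ltnS leqW.
  by apply: cellP; rewrite /cell/= ger0_norm; move: ti; rewrite -natr1; lra.
- rewrite nth_mkseq; last by rewrite !ltnS.
  by apply: cellP; rewrite /cell/= ler0_norm; move: it ti; rewrite -natr1; lra.
Unshelve. all: by end_near. Qed.

Lemma Baire1P f : Baire1_fun X f <-> preimages_in (Fsigma X) f.
Proof.
split=> [[g [cg gf]] U oU|/interp_limit[g [Dg gf]]]; last first.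
  exists g; split => // n; have [p _ <-] := Dg n; exact: sub_interp_continuous.
(* With [q = (p, N)], these are the points whose values under [g n] stay in the rational interval
   [p] from [N] on. The interval is closed, so the limit stays in it too. *)
pose E (q : (rat * rat) * nat) := \bigcap_n (g (q.2 + n)%N @^-1` clip_itv U q.1).
rewrite (_ : f @^-1` U = \bigcup_q E q).
  apply: Fsigma_bigcup_closed => q; apply: sub_closed_bigcap => n.
  rewrite -[X in sub_closed _ X]setCK; apply: sub_openC; rewrite preimage_setC.
  by apply: cg; apply: closed_openC; exact: closed_clip_itv.
apply/seteqP; split=> [x Ux|x [q _ Ex]].
  have [p [pU fx]] := open_rat_itv _ _ oU Ux.
  have [N _ NP] := gf x _ fx.
  exists (p, N) => // n _; split => //=.
  by have := NP (N + n)%N (leq_addr _ _); rewrite /= in_itv.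
have [qU _] := Ex 0%N I; apply: qU.
apply: (closed_cvg _ _ _ _ (gf x)); first exact: interval_closed.
exists q.2 => // n /= qn; rewrite in_itv/=.
by have [_] := Ex (n - q.2)%N I; rewrite subnKC.
Qed.

Lemma seq_separable_Baire1 : SeqDense X (B1X X) (range sub_interp).
Proof.
split; first exact: countable_range_countType.
split=> [_ [p _ <-]|f /Baire1P]; last exact: interp_limit.
exists (fun=> sub_interp p); split=> [n|x]; first exact: sub_interp_continuous.
exact: cvg_cst.
Qed.

End BaireOne.

(** * Sequentially dense sets of functions and domination *)

Section FunctionSpaces.
Context {R : realType} (X : set R).
Local Open Scope ring_scope.

Lemma Sfin_SeqDense_domination (C : set (set (sub X))) D :
  setI_closed C -> (forall A B, C A -> C B -> C (A `|` B)) ->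
  sub_open X `<=` C -> sub_closed X `<=` C ->
  SeqDense X (preimages_in X C) D ->
  Sfin (SeqDense X (preimages_in X C)) (SeqDense X (preimages_in X C)) ->
  domination (sub_closed X).
Proof.
move=> CI CU Copen Cclosed [cD [DY Ddense]] sfin.
apply: domination_nonincreasing => [|A cA ndA niA covA]; first exact: sub_closedI.
have [X0|/existsNP[x0 _]] := pselect (forall x : sub X, False).
  by exists (fun=> 0%N) => x; have := X0 x.
have Ccst c : preimages_in X C (cst c).
  move=> U _; apply: Cclosed; rewrite preimage_cst.
  by case: ifP => _; [exact: sub_closedT|exact: sub_closed0].
have [d dD] : exists d : nat -> sub X -> R, range d = D.
  apply: countable_enum => //; have [g [Dg _]] := Ddense _ (Ccst 0).
  by exists (g 0%N).
have Dd i : D (d i) by rewrite -dD; exists i.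
pose h n (p : nat * nat) x := if `[< A n p.2 x >] then d p.1 x else 2.
have hS n : SeqDense X (preimages_in X C) (range (h n)).
  split; first exact: countable_range_countType.
  split=> [_ [[i k] _ <-] U oU|f /Ddense[g [Dg gf]]].
    rewrite (_ : _ @^-1` _ =
      (A n k `&` d i @^-1` U) `|` (~` A n k `&` cst (2 : R) @^-1` U)).
      apply: CU; apply: CI.
      - exact: Cclosed.
      - exact: DY.
      - exact/Copen/sub_closedC.
      - exact: Ccst.
    apply/seteqP; split=> x; rewrite /h/=.
      by case: asboolP => Ax Ux; [left|right].
    by case: asboolP => Ax [[]|[]].
  have /choice[i iP] j : exists i, d i = g j.
    by have := Dg j; rewrite -dD => -[i _ <-]; exists i.
  (* At a given [x] this agrees with [g j] as soon as [A n j] contains [x]. *)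
  exists (fun j => h n (i j, j)); split=> [j|x]; first by exists (i j, j).
  apply: cvg_trans (gf x); apply: near_eq_cvg.
  have [k Ak] := covA n x; exists k => // j /= kj.
  rewrite /h/= iP; case: asboolP => // nA.
  by exfalso; apply: nA; move: Ak; apply/subsetPset/ndA.
have [F [FP [cW [_ Wdense]]]] := sfin _ hS.
(* Only countably many functions are selected, so a constant [c] can differ from all their values at
   [x0] and from the marker value 2. *)
have [c cP] : exists c, ~ ((fun w => w x0) @` (\bigcup_n F n) `|` [set 2]) c.
  apply: countable_avoid; rewrite -bigcup2E.
  apply: bigcup_countable => // -[|[|n]] _ //=.
  exact: sub_countable (card_image_le _ _) cW.
have c2 : c != 2 by apply/eqP => c2; apply: cP; right.
have Fc n w : F n w -> w x0 != c.
  by move=> Fw; apply/eqP => wc; apply: cP; left; exists w => //; exists n.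
have [g [Wg gc]] := Wdense _ (Ccst c).
have /choice[n nP] j : exists n, F n (g j) by have [n _ Fg] := Wg j; exists n.
have /choice[p pP] j : exists p, h (n j) p = g j.
  by have [_ /(_ _ (nP j))[p _ <-]] := FP (n j); exists p.
(* The constant [c] is not in any [F n], so the sequence [g] must leave each
   finite set [F n] for ever. *)
have /choice[j jP] m : exists j, (m <= j)%N /\ (m <= n j)%N.
  have : \forall j \near \oo, forall w, (\bigcup_(i in `I_m) F i) w -> g j <> w.
    apply: near_finite_set.
      by apply: bigcup_finite => // i _; have [] := FP i.
    move=> w [i _ Fw]; have /cvgrPdist_lt/(_ `|c - w x0|) := gc x0.
    rewrite normr_gt0 subr_eq0 eq_sym => /(_ (Fc _ _ Fw)).
    by apply: filterS => j + gw; rewrite gw ltxx.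
  move=> [M _ MP]; exists (maxn m M); split; first exact: leq_maxl.
  rewrite leqNgt; apply/negP => nm.
  by apply: (MP _ (leq_maxr m M) _ _ erefl); exists (n (maxn m M)).
(* This is the index of the closed set used by [g (j m)]. Where that function is not 2 the point
   lies in the closed set, whose stage [n (j m)] is at least [m]; monotonicity brings it back to
   stage [m]. *)
exists (fun m => (p (j m)).2) => x.
have : \forall j \near \oo, g j x != 2.
  have /cvgrPdist_lt/(_ `|c - 2|) := gc x.
  rewrite normr_gt0 subr_eq0 => /(_ c2).
  by apply: filterS => i; apply: contraTneq => ->; rewrite ltxx.
move=> [M _ MP]; exists M => // m /= Mm; have [mj mn] := jP m.
apply: (niA _ _ _ mn); have := MP _ (leq_trans Mm mj).
by rewrite /= -pP /h; case: asboolP => //; rewrite eqxx.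
Qed.

Lemma Borel_dist_le (u v : sub X -> R) e : Borel_fun X u -> Borel_fun X v ->
  sub_Borel X [set x | `|u x - v x| <= e].
Proof.
have Bgt (a b : sub X -> R) : Borel_fun X a -> Borel_fun X b ->
    sub_Borel X [set x | e < a x - b x].
  move=> Ba Bb; rewrite (_ : [set x | _] = \bigcup_(q : rat)
      (a @^-1` `]ratr q, +oo[ `&` b @^-1` `]-oo, ratr q - e[)).
    apply: Borel_bigcup => q; apply: BorelI.
      by apply: Ba; exact: interval_open.
    by apply: Bb; exact: interval_open.
  apply/seteqP; split=> x /=; last first.
    by move=> [q _ [/=]]; rewrite !in_itv/=; lra.
  move=> eab; have [q] : exists q : rat, ratr q \in `]b x + e, a x[%R.
    by apply: rat_in_itvoo; lra.
  rewrite in_itv/= => /andP[bq qa]; exists q => //=; rewrite !in_itv/= andbT.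
  by split; lra.
move=> Bu Bv; rewrite (_ : [set x | _] =
    ~` [set x | e < u x - v x] `&` ~` [set x | e < v x - u x]).
  by apply: BorelI; apply: BorelC; exact: Bgt.
apply/seteqP; split=> x /=.
  by rewrite ler_norml => /andP[? ?]; split; apply/negP; rewrite -leNgt; lra.
move=> [/negP + /negP]; rewrite -!leNgt => ? ?.
by rewrite ler_norml; apply/andP; split; lra.
Qed.

(** Pointwise convergence puts every point, for some [k], in the set where [G n] stays within
    [1/(n+1)] of [g n] from [k] on. These sets are Borel, and a dominating [kappa] makes the error
    tend to 0 at each point. *)
Lemma ptws_cvg_diag (G : nat -> nat -> sub X -> R) g f :
  domination (sub_Borel X) ->
  (forall n k, Borel_fun X (G n k)) -> (forall n, Borel_fun X (g n)) ->
  (forall n, ptws_cvg X (G n) (g n)) -> ptws_cvg X g f ->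
  exists kappa : nat -> nat, ptws_cvg X (fun n => G n (kappa n)) f.
Proof.
move=> dom BG Bg Gg gf.
pose A n k := \bigcap_j [set x | `|G n (k + j)%N x - g n x| <= n.+1%:R^-1].
have [||n x|kappa kP] := dom A.
- by move=> n k; apply: Borel_bigcap => j; exact: Borel_dist_le.
- move=> n k l kl; apply/subsetPset => x Ax j _.
  by have := Ax (l - k + j)%N I; rewrite addnA subnKC.
- have n0 : 0 < n.+1%:R^-1 :> R by rewrite invr_gt0.
  have /cvgrPdist_le/(_ _ n0)[k _ kP] := Gg n x.
  by exists k => j _ /=; rewrite distrC; apply: kP; exact: leq_addr.
exists kappa => x; apply/cvgrPdist_le => e e0.
have e20 : 0 < e / 2 by lra.
near=> n.
have An : A n (kappa n) x by near: n; exact: kP.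
have ne : n.+1%:R^-1 < e / 2.
  by near: n; exact: (near_infty_natSinv_lt (PosNum e20)).
have fg : `|f x - g n x| <= e / 2.
  by near: n; move/cvgrPdist_le : (gf x); exact.
have := An 0%N I; rewrite /= addn0 distrC => gG.
rewrite (_ : _ - _ = (f x - g n x) + (g n x - G n (kappa n) x)); last by ring.
by rewrite (le_trans (ler_normD _ _))//; have := le_lt_trans gG ne; lra.
Unshelve. all: by end_near. Qed.

(** Coding pairs [(i, m)] as stages gives each [d i] infinitely many stages. One diagonalisation
    makes the functions chosen there converge to [d i]; a second reaches an arbitrary [f] along a
    sequence of the [d i]. *)
Lemma domination_S1_SeqDense D : domination (sub_Borel X) ->
  SeqDense X (BX X) D -> S1 (SeqDense X (BX X)) (SeqDense X (BX X)).
Proof.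
move=> dom [cD [DB Ddense]] S SP.
have B0 : BX X (cst 0).
  move=> U _; rewrite preimage_cst; apply: Borel_closed.
  by case: ifP => _; [exact: sub_closedT|exact: sub_closed0].
have [d dD] : exists d : nat -> sub X -> R, range d = D.
  apply: countable_enum => //; have [g [Dg _]] := Ddense _ B0.
  by exists (g 0%N).
have Dd i : D (d i) by rewrite -dD; exists i.
have /choice[G GP] (p : nat * nat) : exists g : nat -> sub X -> R,
    (forall k, S (pickle p) (g k)) /\ ptws_cvg X g (d p.1).
  by have [_ [_]] := SP (pickle p); apply; exact: DB.
have SB n : S n `<=` BX X by have [_ []] := SP n.
have /choice[kappa kP] i : exists kappa : nat -> nat,
    ptws_cvg X (fun m => G (i, m) (kappa m)) (d i).
  apply: (@ptws_cvg_diag (fun m => G (i, m)) (fun=> d i)) => //.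
  - by move=> m k; apply: SB; have [+ _] := GP (i, m); apply.
  - by move=> m; exact: DB.
  - by move=> m; have [] := GP (i, m).
  - by move=> x; exact: cvg_cst.
(* A stage that codes no pair takes any element of [S n]. *)
have /choice[b bP] n : exists s, S n s /\
    forall i m, n = pickle (i, m) -> s = G (i, m) (kappa i m).
  have [[[i m] <-]|nN] := pselect (exists p : nat * nat, pickle p = n).
    exists (G (i, m) (kappa i m)); split; first by have [] := GP (i, m).
    by move=> i' m' /(pcan_inj pickleK)[<- <-].
  have [_ [_ Sdense]] := SP n; have [g [Sg _]] := Sdense _ B0.
  by exists (g 0%N); split => // i m nE; exfalso; apply: nN; exists (i, m).
exists b; split=> [n|]; first by have [] := bP n.
split; first exact: countable_range_countType.
split=> [_ [n _ <-]|f /Ddense[g [Dg gf]]]; first by apply: (SB n); have [] := bP n.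
have /choice[i iP] j : exists i, d i = g j.
  by have := Dg j; rewrite -dD => -[i _ <-]; exists i.
have bE k m : b (pickle (k, m)) = G (k, m) (kappa k m).
  by have [_] := bP (pickle (k, m)); apply.
have [||||l lP] := @ptws_cvg_diag (fun j m => b (pickle (i j, m))) g f dom.
- by move=> j m; apply: (SB (pickle (i j, m))); have [] := bP (pickle (i j, m)).
- by move=> j; exact: DB.
- move=> j x; rewrite -iP; under eq_fun do rewrite bE.
  exact: kP.
- by [].
by exists (fun j => b (pickle (i j, l j))); split => // j; eexists.
Qed.

End FunctionSpaces.

(** * The seven equivalences *)

Theorem theorem3p1 (R : realType) (X : set R) :
  let P1 := S1 (SeqDense X (BX X)) (SeqDense X (BX X)) /\ seq_separable X (BX X) in
  let P2 := S1 (B_Gamma X) (B_Gamma X) in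
  let P3 := Sfin (SeqDense X (BX X)) (SeqDense X (BX X)) /\ seq_separable X (BX X) in
  let P4 := Sfin (B_Gamma X) (B_Gamma X) in
  let P5 := S1 (SeqDense X (B1X X)) (SeqDense X (B1X X)) in
  let P6 := S1 (F_Gamma X) (F_Gamma X) in
  let P7 := Sfin (SeqDense X (B1X X)) (SeqDense X (B1X X)) in
  (P1 <-> P2) /\ (P1 <-> P3) /\ (P1 <-> P4) /\ (P1 <-> P5) /\
  (P1 <-> P6) /\ (P1 <-> P7).
Proof.
move=> P1 P2 P3 P4 P5 P6 P7.
have B1E : B1X X = preimages_in X (Fsigma X).
  by apply/funext => f; apply/propext; exact: Baire1P.
pose dom := domination (sub_closed X).
have P3dom : P3 -> dom.
  move=> [sfin [D DP]]; apply: (@Sfin_SeqDense_domination _ _ _ D) DP sfin.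
  - exact: BorelI.
  - exact: BorelU.
  - exact: Borel_open.
  - exact: Borel_closed.
have P7dom : P7 -> dom.
  (* Sequential separability, an explicit clause of [P3], is supplied here by the interpolants. *)
  have := seq_separable_Baire1 X; rewrite /P7 B1E => DP sfin.
  apply: (@Sfin_SeqDense_domination _ _ _ _) DP sfin.
  - exact: FsigmaI.
  - exact: FsigmaU.
  - exact: Fsigma_open.
  - exact: Fsigma_closed.
have P4dom : P4 -> dom.
  move=> /(Sfin_Gamma_domination X _ (BorelI X)) domB A cA.
  by apply: domB => n k; exact: Borel_closed.
have P6dom : P6 -> dom.
  by move=> /S1_Sfin; apply: Sfin_Gamma_domination; exact: sub_closedI.
(* The two function spaces coincide under [dom], which transfers the result for [B(X)] to [B_1(X)]
   and the interpolants to [B(X)]. *)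
have domBE : dom -> B1X X = BX X.
  move=> dX; rewrite B1E; apply/seteqP; split=> f Bf U oU.
    by apply: Fsigma_Borel; exact: Bf.
  by apply: (domination_Borel_Fsigma X dX); exact: Bf.
have domP1 : dom -> P1.
  move=> dX; have := seq_separable_Baire1 X; rewrite (domBE dX) => DP.
  split; last by eexists; exact: DP.
  exact: domination_S1_SeqDense (domination_Borel X dX) DP.
have domP2 : dom -> P2.
  move=> dX; apply: domination_S1_Gamma; last exact: domination_Borel.
  by move=> A BA; exact: Borel_bigcap.
have domP6 : dom -> P6.
  by move=> dX; apply: domination_S1_Gamma => // A; exact: sub_closed_bigcap.
have domP5 : dom -> P5.
  by move=> dX; rewrite /P5 (domBE dX); have [] := domP1 dX.
have P1dom : P1 -> dom by move=> [/S1_Sfin s sep]; exact: P3dom.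
have P2dom : P2 -> dom by move=> /S1_Sfin; exact: P4dom.
have P5dom : P5 -> dom by move=> /S1_Sfin; exact: P7dom.
have domP3 : dom -> P3 by move=> /domP1[s sep]; split => //; exact: S1_Sfin.
have domP4 : dom -> P4 by move=> /domP2; exact: S1_Sfin.
have domP7 : dom -> P7 by move=> /domP5; exact: S1_Sfin.
have P1E (Q : Prop) : (Q -> dom) -> (dom -> Q) -> (P1 <-> Q).
  by move=> Qdom domQ; split=> [/P1dom/domQ|/Qdom/domP1].
by do 5!(split; first exact: P1E); exact: P1E.
Qed.
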